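(* Let $n \geq 1$ and consider a finite graph whose vertex set is a disjoint union $A_0 \cup A_1 \cup \cdots \cup A_n$ and such that each edge is between $A_{i-1}$ and $A_i$ for some $i \in \{1,\dots,n\}$. For $i = 1, \ldots, n$ let $X_i$ be the simplicial complex on $A_{i-1} \cup A_i$ whose Stanley-Reisner ideal is the edge ideal given by the edges between $A_{i-1}$ and $A_i$. Let $X$ be the simplicial complex on $A_0 \cup \cdots \cup A_n$ whose Stanley-Reisner ideal is generated by the products $x_{a_0}x_{a_1}\cdots x_{a_n}$ where $a_i \in A_i$ for $i=0,\dots,n$ and $\{a_{i-1},a_i\}$ is an edge of the graph for each $i = 1, \ldots, n$. Then $X$ is homotopy equivalent to the join $X_1 * X_2 * \cdots * X_n$.
   Context: The edge ideal given by a set of edges is the ideal generated by the monomials $x_ux_v$ for $\{u,v\}$ an edge in the set. The join $X * Y$ of simplicial complexes on disjoint vertex sets is the simplicial complex on the union of the vertex sets whose faces are all $F \cup G$ with $F \in X$, $G \in Y$. In the join $X_1 * \cdots * X_n$ the complexes $X_i$ are placed on pairwise disjoint copies of the vertex sets $A_{i-1}\cup A_i$. Homotopy equivalence of simplicial complexes means homotopy equivalence of geometric realizations. *)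

(* Defs.v *)
From HB Require Import structures.
From mathcomp Require Import all_boot all_order all_algebra.
From mathcomp Require Import all_classical all_reals all_analysis.
(* The notations of mpoly clash with those of mathcomp-analysis. *)
From mathcomp Require Import -(notations) mpoly.
Import Order.TTheory GRing.Theory Num.Theory.
Import numFieldNormedType.Exports.

Set Implicit Arguments.
Unset Strict Implicit.
Unset Printing Implicit Defensive.

Local Open Scope ring_scope.

(* The empty set is a face, but a vertex of V need not be one, as usual in
   Stanley-Reisner theory. *)
Record scomplex (V : finType) := SComplex {
  face : {set V} -> Prop;
  face0 : face finset.set0;
  face_sub : forall F G : {set V}, G \subset F -> face F -> face G
}.

Section Join.
Variables (I : finType) (V : I -> finType) (K : forall i, scomplex (V i)).

(* The sigma type {i : I & V i} makes the vertex sets pairwise disjoint. *)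
Definition join_face (F : {set {i : I & V i}}) : Prop :=
  exists G : forall i, {set V i},
    (forall i, face (K i) (G i)) /\
    F = (\bigcup_(i : I) [set Tagged V v | v in G i])%SET.

Lemma join_face0 : join_face finset.set0.
Proof.
exists (fun=> finset.set0); split=> [i|]; first exact: face0.
by rewrite big1 // => i _; rewrite imset0.
Qed.

Lemma join_face_sub (F G : {set {i : I & V i}}) :
  G \subset F -> join_face F -> join_face G.
Proof.
move=> GF [H [HK FE]]; exists (fun i => [set v | Tagged V v \in G])%SET.
have mem_slice i (v : V i) : Tagged V v \in F -> v \in H i.
  rewrite FE => /bigcupP[j _ /imsetP[w wH E]].
  have ij : i = j by exact: (congr1 tag E).
  case: j / ij w wH E => w wH E.
  by move/eqP: E; rewrite eq_Tagged => /eqP /= ->.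
split=> [i|].
  apply: face_sub (HK i); apply/fintype.subsetP => v; rewrite inE => vG.
  exact/mem_slice/(fintype.subsetP GF).
apply/finset.setP => -[i v]; apply/idP/bigcupP => [ivG|[j _ /imsetP[w]]].
  by exists i => //; apply/imsetP; exists v; rewrite ?inE.
by rewrite inE => wG ->.
Qed.

Definition join : scomplex {i : I & V i} := SComplex join_face0 join_face_sub.

End Join.

Section Ideals.

Definition ideal_gen (A : comNzRingType) (S : set A) : set A :=
  [set p | exists (m : nat) (c g : 'I_m -> A),
     (forall j, S (g j)) /\ p = \sum_j c j * g j]%classic.

Variables (k : fieldType) (V : finType).

(* k[x_v : v in V], the variables being numbered by the enumeration of V *)
Definition polyring : comNzRingType := mpoly #|V| k.

Definition pvar (v : V) : polyring := mpolyX k (mnm1 (enum_rank v)).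

Definition SR_ideal (K : scomplex V) : set polyring :=
  ideal_gen [set p | exists F : {set V},
    ~ face K F /\ p = \prod_(v in F) pvar v]%classic.

Definition edge_ideal (e : rel V) : set polyring :=
  ideal_gen [set p | exists u v : V, e u v /\ p = pvar u * pvar v]%classic.

End Ideals.

Arguments pvar k {V} v.
Arguments SR_ideal k {V} K.
Arguments edge_ideal k {V} e.

Section Realization.
Variables (R : realType) (V : finType).

(* R^V carries the product topology and the realization the topology induced
   on the subset type. *)
Definition realization (K : scomplex V) : topologicalType :=
  set_type ([set x : {ptws V -> R} |
    [/\ forall v, 0 <= x v, \sum_v x v = 1 &
        face K [set v | x v != 0]%SET]]%classic).

End Realization.

Section Homotopy.
Variable R : realType.

Definition homotopic (X Y : topologicalType) (f g : X -> Y) : Prop :=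
  exists H : X * R -> Y,
    [/\ {within [set: X] `*` `[0, 1], continuous H}%classic,
        forall x, H (x, 0) = f x & forall x, H (x, 1) = g x].

Definition homotopy_equivalent (X Y : topologicalType) : Prop :=
  exists (f : X -> Y) (g : Y -> X),
    [/\ continuous f, continuous g,
        homotopic (g \o f) id & homotopic (f \o g) id].

End Homotopy.

Section LayeredGraph.
Variables (T : finType) (n : nat) (A : 'I_n.+1 -> {set T}) (e : rel T).

(* For i : 'I_n, these are the two ends of the i-th step: prevL i and nextL i
   have values i and i + 1. *)
Definition prevL (i : 'I_n) : 'I_n.+1 := widen_ord (leqnSn n) i.
Definition nextL (i : 'I_n) : 'I_n.+1 := lift ord0 i.

Definition between (i : 'I_n) (u v : T) : bool :=
  (u \in A (prevL i)) && (v \in A (nextL i)) ||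
  (v \in A (prevL i)) && (u \in A (nextL i)).

Definition layer (i : 'I_n) : finType :=
  {v : T | v \in (A (prevL i) :|: A (nextL i))%SET}.

Definition layer_edge (i : 'I_n) : rel (layer i) :=
  fun u v => e (val u) (val v) && between i (val u) (val v).

Definition layer_path_ideal (k : fieldType) : set (polyring k T) :=
  ideal_gen [set p | exists a : 'I_n.+1 -> T,
    [/\ forall i, a i \in A i,
        forall i : 'I_n, e (a (prevL i)) (a (nextL i)) &
        p = \prod_i pvar k (a i)]]%classic.

End LayeredGraph.

Arguments layer_edge {T n} A e i u v.
Arguments layer_path_ideal {T n} A e k.

(* Main.v *)
Require Import Defs.
From mathcomp Require Import -(notations) mpoly.
From mathcomp Require Import all_boot all_order all_algebra.
From mathcomp Require Import all_classical all_reals all_analysis.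
From mathcomp Require Import lra.
Import Order.TTheory GRing.Theory Num.Theory.
Import numFieldNormedType.Exports.

(** Orient every edge from layer i - 1 to layer i.  A set of vertices is a face
    of X if and only if it contains no directed path from the first layer to
    the last one; this is read off the ideals by evaluating polynomials at the
    0/1 points of affine space ([nonface_gen]).

    Split a vertex a of an inner layer in two: a source, which keeps the edges
    leaving a, and a sink, which keeps the edges entering a.  Consider the
    complex of all vertex sets that contain no directed path from a source to a
    sink, the first and the last layer counting as split from the start.
    Before any inner vertex is split, this complex is X
    ([path_complex_equivalence]).  Once all of them are split, every path is a
    single edge, from a source in layer i - 1 to a sink in layer i; these are
    the edges defining X_i, and sources in layer i - 1 together with sinks in
    layer i are its vertices, so the complex is the join ([join_equivalence]).

    It remains to see that splitting one vertex a does not change the homotopy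
    type.  Let p and q be its source and its sink.  A path through a consists
    of a path ending in q and a path starting in p.  Hence G + a contains a path
    exactly when both G + q and G + p do ([path_free_on]), that is, the complex
    before splitting arises from the one after splitting by contracting the
    edge pq.  No path runs from p to q since layers increase along paths, so
    G + p + q is path-free as soon as G + p and G + q are
    ([path_free_link]): the contracted edge satisfies the link condition
    lk p :&: lk q = lk pq, and such a contraction is a homotopy equivalence
    ([contraction_equivalence]).

    For the last fact a homotopy inverse is written down explicitly.  A point y
    of the contracted complex, with weight t on the merged vertex, is lifted by
    lowering all other weights by t and by distributing t between p and q.  The
    lowering removes the small weights, which makes room in which the weight
    can move continuously from p to q: with [depth r y] measuring how far the
    support of y is from spanning a face together with r, the share of p goes
    from 0 to t while [depth q y - depth p y] goes from -t to t.  All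
    homotopies needed are straight lines inside faces, performed in two steps:
    first lower the weights, then move the weight between p and q. *)

Set Implicit Arguments.
Unset Strict Implicit.
Unset Printing Implicit Defensive.

Local Open Scope classical_set_scope.
Local Open Scope ring_scope.

(** * Homotopies and homotopy equivalences *)

Section HomotopyCalculus.
Variable R : realType.
Implicit Types X Y Z : topologicalType.

Definition clamp (t : R) : R := Num.max 0 (Num.min 1 t).

Lemma clamp_ge0 t : 0 <= clamp t.
Proof. by rewrite /clamp le_max lexx. Qed.

Lemma clamp_le1 t : clamp t <= 1.
Proof. by rewrite /clamp ge_max ler01 ge_min lexx. Qed.

Lemma clamp_id t : 0 <= t <= 1 -> clamp t = t.
Proof. by move=> /andP[t0 t1]; rewrite /clamp (min_idPr t1) (max_idPr t0). Qed.

Lemma continuous_fun_min Z (f g : Z -> R) :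
  continuous f -> continuous g -> continuous (fun z => Num.min (f z) (g z)).
Proof. by move=> cf cg; exact: min_fun_continuous. Qed.

Lemma continuous_fun_max Z (f g : Z -> R) :
  continuous f -> continuous g -> continuous (fun z => Num.max (f z) (g z)).
Proof. by move=> cf cg; exact: max_fun_continuous. Qed.

Lemma continuous_fun_add Z (f g : Z -> R) :
  continuous f -> continuous g -> continuous (fun z => f z + g z).
Proof. by move=> cf cg z; apply: cvgD; [exact: cf|exact: cg]. Qed.

Lemma continuous_fun_sub Z (f g : Z -> R) :
  continuous f -> continuous g -> continuous (fun z => f z - g z).
Proof. by move=> cf cg z; apply: cvgB; [exact: cf|exact: cg]. Qed.

Lemma continuous_fun_mul Z (f g : Z -> R) :
  continuous f -> continuous g -> continuous (fun z => f z * g z).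
Proof. by move=> cf cg z; apply: cvgM; [exact: cf|exact: cg]. Qed.

Lemma continuous_clamp Z (f : Z -> R) :
  continuous f -> continuous (fun z => clamp (f z)).
Proof.
move=> cf; apply: continuous_fun_max; first exact: cst_continuous.
by apply: continuous_fun_min => //; exact: cst_continuous.
Qed.

Lemma continuous_pair Z X Y (f : Z -> X) (g : Z -> Y) :
  continuous f -> continuous g -> continuous (fun z => (f z, g z)).
Proof. by move=> cf cg z; apply: cvg_pair; [exact: cf|exact: cg]. Qed.

Lemma continuous_fst X Y : continuous (@fst X Y).
Proof. by move=> z; exact: cvg_fst. Qed.

Lemma continuous_snd X Y : continuous (@snd X Y).
Proof. by move=> z; exact: cvg_snd. Qed.

Lemma continuous_o X Y Z (f : X -> Y) (g : Y -> Z) :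
  continuous f -> continuous g -> continuous (g \o f).
Proof. by move=> cf cg x; apply: continuous_comp; [exact: cf|exact: cg]. Qed.

(** Precomposing the parameter with the retraction of the line onto the unit
    interval makes a homotopy continuous on the whole product; compositions
    and pastings can then be done without restricting to a subspace. *)
Lemma homotopic_global X Y (f g : X -> Y) : homotopic R f g ->
  exists H : X * R -> Y, [/\ continuous H,
    forall x t, t <= 0 -> H (x, t) = f x &
    forall x t, 1 <= t -> H (x, t) = g x].
Proof.
move=> [H [Hc H0 H1]]; exists (fun z => H (z.1, clamp z.2)); split.
- move=> z; pose c (z : X * R) := (z.1, clamp z.2).
  have cc : continuous c.
    apply: continuous_pair; first exact: continuous_fst.
    by apply: continuous_clamp; exact: continuous_snd.
  have cI w : ([set: X] `*` `[0, 1]) (c w).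
    by split => //=; rewrite in_itv /= clamp_ge0 clamp_le1.
  move=> P HP; have /subspace_continuousP/(_ (c z) (cI z) P HP) := Hc.
  move=> /cc; apply: (@filterS _ (nbhs z)) => w Hw; exact: (Hw (cI w)).
- by move=> x t t0; rewrite /clamp /= min_r ?(le_trans t0)// max_l.
- by move=> x t t1; rewrite /clamp /= min_l // max_r.
Qed.

Lemma homotopic_intro X Y (f g : X -> Y) (H : X * R -> Y) :
  continuous H -> (forall x, H (x, 0) = f x) -> (forall x, H (x, 1) = g x) ->
  homotopic R f g.
Proof.
by move=> Hc H0 H1; exists H; split=> //; exact: continuous_subspaceT.
Qed.

Lemma homotopic_trans X Y (g f h : X -> Y) :
  homotopic R f g -> homotopic R g h -> homotopic R f h.
Proof.
move=> /homotopic_global[H [Hc H0 H1]] /homotopic_global[G [Gc G0 G1]].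
pose A : set (X * R) := [set z | z.2 <= 2^-1].
pose B : set (X * R) := [set z | 2^-1 <= z.2].
pose L (z : X * R) := if z.2 <= 2^-1 then H (z.1, 2 * z.2)
                      else G (z.1, 2 * z.2 - 1).
have c1 : continuous (fun z : X * R => (z.1, 2 * z.2)).
  apply: continuous_pair; first exact: continuous_fst.
  by move=> z; apply: cvgM; [exact: cvg_cst|exact: continuous_snd].
have c2 : continuous (fun z : X * R => (z.1, 2 * z.2 - 1)).
  apply: continuous_pair; first exact: continuous_fst.
  move=> z; apply: cvgB; last exact: cvg_cst.
  by apply: cvgM; [exact: cvg_cst|exact: continuous_snd].
apply: (@homotopic_intro _ _ _ _ L).
- have AB : A `|` B = setT.
    apply/seteqP; split=> // z _.
    by case/orP: (le_total z.2 2^-1) => ?; [left|right].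
  apply/continuous_subspace_setT; rewrite -AB; apply: withinU_continuous.
  + apply: (@preimage_closed _ _ snd [set r : R | r <= 2^-1]).
      by move=> z _; exact: continuous_snd.
    exact: closed_le.
  + apply: (@preimage_closed _ _ snd [set r : R | 2^-1 <= r]).
      by move=> z _; exact: continuous_snd.
    exact: closed_ge.
  + apply: (@subspace_eq_continuous _ A _ (fun z => H (z.1, 2 * z.2))).
      by move=> z; rewrite inE => zA; rewrite /from_subspace /L ifT.
    exact/continuous_subspaceT/(continuous_o c1 Hc).
  + apply: (@subspace_eq_continuous _ B _ (fun z => G (z.1, 2 * z.2 - 1))).
      move=> z; rewrite inE /from_subspace /L => zB; case: ifP => // zA.
      have {zA zB} : z.2 = 2^-1 by apply/eqP; rewrite eq_le zA.
      move=> ->.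
      by rewrite G0 ?H1 //; lra.
    exact/continuous_subspaceT/(continuous_o c2 Gc).
- by move=> x; rewrite /L /= invr_ge0 ler0n H0 // mulr0.
- move=> x; rewrite /L /= ifF ?G1 //; [lra|apply/negbTE; rewrite -ltNge; lra].
Qed.

Lemma homotopic_comp X Y Z (W : topologicalType)
    (a : X -> Y) (f g : Y -> Z) (b : Z -> W) :
  continuous a -> continuous b ->
  homotopic R f g -> homotopic R (b \o f \o a) (b \o g \o a).
Proof.
move=> ca cb /homotopic_global[H [Hc H0 H1]].
apply: (@homotopic_intro _ _ _ _ (fun z => b (H (a z.1, z.2)))).
- apply: (continuous_o _ cb); apply: (continuous_o _ Hc).
  apply: continuous_pair; last exact: continuous_snd.
  exact: (continuous_o (@continuous_fst _ _) ca).
- by move=> x /=; rewrite H0.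
- by move=> x /=; rewrite H1.
Qed.

Lemma homotopy_equivalent_sym X Y :
  homotopy_equivalent R X Y -> homotopy_equivalent R Y X.
Proof. by move=> [f [g [fc gc gf fg]]]; exists g, f. Qed.

Lemma homotopy_equivalent_trans X Y Z : homotopy_equivalent R X Y ->
  homotopy_equivalent R Y Z -> homotopy_equivalent R X Z.
Proof.
move=> [f [f' [fc f'c f'f ff']]] [g [g' [gc g'c g'g gg']]].
exists (g \o f), (f' \o g'); split.
- exact: continuous_o.
- exact: continuous_o.
- by apply: homotopic_trans f'f; exact: (homotopic_comp fc f'c g'g).
- by apply: homotopic_trans gg'; exact: (homotopic_comp g'c gc ff').
Qed.

End HomotopyCalculus.

(** * Points of a realization *)

Section RealizationPoints.
Variables (R : realType) (V : finType).
Implicit Types K : scomplex V.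

Definition bcoord K (x : realization R K) : V -> R := set_val x.

Lemma bcoordP K (x : realization R K) :
  [/\ forall v, 0 <= bcoord x v, \sum_v bcoord x v = 1 &
      face K [set v | bcoord x v != 0]%SET].
Proof. exact: set_valP x. Qed.

Lemma bcoord_ge0 K (x : realization R K) v : 0 <= bcoord x v.
Proof. by have [] := bcoordP x. Qed.

Lemma bcoord_sum K (x : realization R K) : \sum_v bcoord x v = 1.
Proof. by have [] := bcoordP x. Qed.

Lemma bcoord_le1 K (x : realization R K) v : bcoord x v <= 1.
Proof.
rewrite -(bcoord_sum x) (bigD1 v) //= lerDl sumr_ge0 // => w _.
exact: bcoord_ge0.
Qed.

Lemma bcoord_inj K (x y : realization R K) : bcoord x =1 bcoord y -> x = y.
Proof. by move=> xy; apply: val_inj; apply/funext. Qed.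

Lemma continuous_bcoord K v :
  continuous (fun x : realization R K => bcoord x v).
Proof.
have cp : continuous (fun x : {ptws V -> R} => x v).
  exact: proj_continuous.
have cv : continuous (set_val : realization R K -> {ptws V -> R}).
  exact: initial_continuous.
exact: (continuous_o cv cp).
Qed.

Lemma continuous_realization K (Z : topologicalType)
    (f : Z -> realization R K) :
  (forall v, continuous (fun z => bcoord (f z) v)) -> continuous f.
Proof.
move=> cf; apply: continuous_comp_initial => z.
apply/cvg_sup => v; move: z.
apply/(@continuousP _ (initial_topology (fun x : V -> R => x v))).
move=> A [B oB <-].
apply: (@open_comp _ _ (fun z => bcoord (f z) v) B) => // z _.
Qed.

End RealizationPoints.

Section Cone.
Variables (R : realType) (V : finType).
Implicit Types (K : scomplex V) (h : V -> R).

Definition supp h : {set V} := [set v | h v != 0]%SET.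

(** Homogeneous coordinates for the realization: explicit maps are easier to
    write without keeping the sum of the coordinates equal to 1. *)
Definition in_cone K h : Prop :=
  [/\ forall v, 0 <= h v, exists v, h v != 0 & face K (supp h)].

Lemma exists_neq0_of_sum1 h : \sum_v h v = 1 -> exists v, h v != 0.
Proof.
move=> h1; apply: contrapT => /forallNP h_0; have := oner_neq0 R.
rewrite -h1 big1 ?eqxx // => v _.
by have /negP := h_0 v; rewrite negbK => /eqP.
Qed.

Lemma in_cone_sum_gt0 K h : in_cone K h -> 0 < \sum_v h v.
Proof.
move=> [h0 [v hv] _]; rewrite (bigD1 v) //= ltr_wpDr ?sumr_ge0 //.
by rewrite lt_neqAle eq_sym hv h0.
Qed.

Lemma normalize_subproof K h (hK : in_cone K h) :
  [set x : {ptws V -> R} | [/\ forall v, 0 <= x v, \sum_v x v = 1 &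
     face K [set v | x v != 0]%SET]] (fun v => h v / \sum_w h w).
Proof.
have s0 := in_cone_sum_gt0 hK; have [h0 _ hF] := hK; split.
- by move=> v; rewrite divr_ge0 // ltW.
- by rewrite -mulr_suml divff // gt_eqF.
- apply: face_sub hF; apply/fintype.subsetP => v; rewrite !inE mulf_eq0 negb_or.
  by case/andP.
Qed.

Definition normalize K h (hK : in_cone K h) : realization R K :=
  @exist {ptws V -> R} _ _ (mem_set (normalize_subproof hK)).

Lemma bcoord_normalize K h (hK : in_cone K h) v :
  bcoord (normalize hK) v = h v / \sum_w h w.
Proof. by []. Qed.

Lemma supp_normalize K h (hK : in_cone K h) :
  supp (bcoord (normalize hK)) = supp h.
Proof.
apply/finset.setP => v; rewrite !inE bcoord_normalize mulf_eq0 invr_eq0.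
by rewrite (gt_eqF (in_cone_sum_gt0 hK)) orbF.
Qed.

Lemma continuous_sum (Z : topologicalType) (h : Z -> V -> R) :
  (forall v, continuous (h^~ v)) -> continuous (fun z => \sum_v h z v).
Proof.
move=> ch; apply: (@continuous_big R^o V +%R 0 xpredT _ Z (index_enum V)
  (fun v z => h z v)) => //.
by move=> z; exact: add_continuous.
Qed.

Lemma continuous_normalize K (Z : topologicalType) (h : Z -> V -> R)
    (hK : forall z, in_cone K (h z)) :
  (forall v, continuous (h^~ v)) -> continuous (fun z => normalize (hK z)).
Proof.
move=> ch; apply: continuous_realization => v z; rewrite /continuous_at /=.
apply: cvgM; first exact: ch.
apply: cvgV; first by rewrite gt_eqF // (in_cone_sum_gt0 (hK z)).
exact: continuous_sum.
Qed.

Lemma in_cone_bcoord K (x : realization R K) : in_cone K (bcoord x).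
Proof.
have [x0 x1 xF] := bcoordP x; split=> //.
exact: exists_neq0_of_sum1.
Qed.

Lemma bcoord_normalize1 K h (hK : in_cone K h) :
  \sum_v h v = 1 -> bcoord (normalize hK) =1 h.
Proof. by move=> h1 v; rewrite bcoord_normalize h1 divr1. Qed.

(** Two maps that always send a point into a common face are joined by the
    straight-line homotopy. *)
Lemma homotopic_straight (X : topologicalType) K (f g : X -> realization R K) :
  continuous f -> continuous g ->
  (forall x, face K (supp (bcoord (f x)) :|: supp (bcoord (g x)))%SET) ->
  homotopic R f g.
Proof.
move=> cf cg fg.
pose h (z : X * R) v :=
  (1 - clamp z.2) * bcoord (f z.1) v + clamp z.2 * bcoord (g z.1) v.
have h1 z : \sum_v h z v = 1.
  by rewrite big_split /= -!mulr_sumr !bcoord_sum !mulr1 subrK.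
have hK z : in_cone K (h z).
  have c0 := clamp_ge0 z.2; have c1 := clamp_le1 z.2.
  split=> [v||].
  - by rewrite addr_ge0 // mulr_ge0 ?subr_ge0 ?bcoord_ge0.
  - exact: exists_neq0_of_sum1.
  - apply: face_sub (fg z.1); apply/fintype.subsetP => v; rewrite !inE.
    apply: contraR; rewrite negb_or !negbK => /andP[/eqP f0 /eqP g0].
    by rewrite /h f0 g0 !mulr0 addr0.
apply: (@homotopic_intro _ _ _ _ _ (fun z => normalize (hK z))).
- apply: continuous_normalize => v z.
  have cc : continuous (fun z : X * R => clamp z.2).
    exact/continuous_clamp/continuous_snd.
  have cb (k : X -> realization R K) : continuous k ->
      continuous (fun z : X * R => bcoord (k z.1) v).
    move=> ck; apply: (@continuous_o _ _ _ (fun z : X * R => k z.1)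
      (fun x => bcoord x v)); last exact: continuous_bcoord.
    exact: (continuous_o (@continuous_fst X R) ck).
  apply: cvgD; apply: cvgM; [|exact: cb|exact: cc|exact: cb].
  by apply: cvgB; [exact: cvg_cst|exact: cc].
- move=> x; apply: bcoord_inj => v; rewrite bcoord_normalize1 // /h /=.
  by rewrite clamp_id ?lexx ?ler01 // subr0 mul1r mul0r addr0.
- move=> x; apply: bcoord_inj => v; rewrite bcoord_normalize1 // /h /=.
  by rewrite clamp_id ?lexx ?ler01 // subrr mul0r mul1r add0r.
Qed.

Lemma homotopic_refl (X : topologicalType) K (f : X -> realization R K) :
  continuous f -> homotopic R f f.
Proof.
move=> cf; apply: homotopic_straight => // x; rewrite finset.setUid.
by case: (bcoordP (f x)).
Qed.

End Cone.

(** * Simplicial maps *)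

Section Relabelling.
Variable R : realType.

Definition simplicial (V W : finType) (K : scomplex V) (L : scomplex W)
  (phi : V -> W) := forall F, face K F -> face L (phi @: F)%SET.

Variables (V W : finType) (K : scomplex V) (L : scomplex W).

Definition push (phi : V -> W) (h : V -> R) (w : W) : R :=
  \sum_(v | phi v == w) h v.

Lemma sum_push phi h : \sum_w push phi h w = \sum_v h v.
Proof.
rewrite [RHS](partition_big phi xpredT) //=.
Qed.

Lemma push_in_cone phi (x : realization R K) :
  simplicial K L phi -> in_cone L (push phi (bcoord x)).
Proof.
move=> phiKL; have [x0 [v xv] xF] := in_cone_bcoord x; split.
- by move=> w; exact: sumr_ge0.
- exists (phi v); rewrite /push (bigD1 v) //= gt_eqF // ltr_wpDr ?sumr_ge0 //.
  by rewrite lt_neqAle eq_sym xv x0.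
- apply: face_sub (phiKL _ xF); apply/fintype.subsetP => w; rewrite !inE.
  apply: contraR => wF; rewrite /push big1 // => u /eqP uw.
  apply/eqP/negPn; apply: contra wF => xu.
  by apply/imsetP; exists u; rewrite ?inE.
Qed.

Definition push_map phi (s : simplicial K L phi) (x : realization R K) :
  realization R L := normalize (push_in_cone x s).

Lemma bcoord_push_map phi (s : simplicial K L phi) x :
  bcoord (push_map s x) =1 push phi (bcoord x).
Proof.
by apply: bcoord_normalize1; rewrite sum_push bcoord_sum.
Qed.

Lemma continuous_push_map phi (s : simplicial K L phi) :
  continuous (push_map s).
Proof.
apply: continuous_normalize => w.
rewrite (_ : (fun _ => _) = fun x : realization R K =>
   \sum_v (if phi v == w then bcoord x v else 0)); last first.
  by apply/funext => x; rewrite /push big_mkcond.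
apply: (@continuous_sum _ _ _ (fun (x : realization R K) v =>
  if phi v == w then bcoord x v else 0)) => v /=; case: (phi v == w).
  exact: continuous_bcoord.
exact: cst_continuous.
Qed.

End Relabelling.

Lemma push_mapK (R : realType) (V W : finType) (K : scomplex V)
    (L : scomplex W) (phi : V -> W) (psi : W -> V)
    (s : simplicial K L phi) (s' : simplicial L K psi) :
  (forall v, face K [set v]%SET -> psi (phi v) = v) ->
  cancel (@push_map R _ _ _ _ _ s) (push_map s').
Proof.
move=> phiK x; apply: bcoord_inj => v; rewrite bcoord_push_map.
rewrite /push; under eq_bigr do rewrite bcoord_push_map.
have -> : \sum_(w | psi w == v) push phi (bcoord x) w =
          \sum_(u | psi (phi u) == v) bcoord x u.
  rewrite [RHS](partition_big phi (fun w => psi w == v)) //=.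
  apply: eq_bigr => w wv; apply: eq_bigl => u.
  by case: eqP => [->|]; rewrite ?wv ?andbF.
have [_ _ xF] := bcoordP x.
rewrite [LHS]big_mkcond /= (bigD1 v) //= big1 => [|u uv].
  rewrite addr0; case: eqP => // nv; apply/esym/eqP/negPn/negP => xv.
  by apply/nv/phiK/(face_sub _ xF); rewrite finset.sub1set inE.
case: eqP => // nv; apply/eqP/negPn/negP => xu.
case/eqP: uv; rewrite -nv; apply/esym/phiK/(face_sub _ xF).
by rewrite finset.sub1set inE.
Qed.

Lemma relabelling_equivalence (R : realType) (V W : finType) (K : scomplex V)
    (L : scomplex W) (phi : V -> W) (psi : W -> V) :
  simplicial K L phi -> simplicial L K psi ->
  (forall v, face K [set v]%SET -> psi (phi v) = v) ->
  (forall w, face L [set w]%SET -> phi (psi w) = w) ->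
  homotopy_equivalent R (realization R K) (realization R L).
Proof.
move=> s s' phiK psiK; exists (push_map s), (push_map s').
split; try exact: continuous_push_map.
- have -> : push_map s' \o push_map s = (id : realization R K -> _).
    by apply/funext; exact: push_mapK.
  by apply: homotopic_refl => x.
- have -> : push_map s \o push_map s' = (id : realization R L -> _).
    by apply/funext; exact: push_mapK.
  by apply: homotopic_refl => x.
Qed.

(** * Contraction of an edge satisfying the link condition *)

(** L is the image of K under the map sending q to p and fixing the other
    vertices; [link] is the link condition for the pair p, q.  Since L lives on
    the same vertex type as K, q stays as an element that is no vertex of L. *)
Section Contraction.
Variables (R : realType) (V : finType) (K L : scomplex V) (p q : V).
Hypothesis pq : p != q.
Hypothesis L_q : forall F : {set V}, face L F -> q \notin F.
Hypothesis L_off : forall G : {set V}, p \notin G -> q \notin G ->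
  face L G <-> face K G.
Hypothesis L_on : forall G : {set V}, p \notin G -> q \notin G ->
  face L (p |: G)%SET <-> face K (p |: G)%SET \/ face K (q |: G)%SET.
Hypothesis link : forall G : {set V}, p \notin G -> q \notin G ->
  face K (p |: G)%SET -> face K (q |: G)%SET -> face K (p |: (q |: G))%SET.

Let qp : (q == p) = false.
Proof. by rewrite eq_sym (negPf pq). Qed.

Let off (F : {set V}) : {set V} := (F :\ p :\ q)%SET.

Let off_p F : p \notin off F.
Proof. by rewrite !inE eqxx andbF. Qed.

Let off_q F : q \notin off F.
Proof. by rewrite !inE eqxx. Qed.

Let off_sub F : off F \subset F.
Proof. by apply/fintype.subsetP => v; rewrite !inE => /and3P[]. Qed.

(** The link condition reduces membership in K to three independent checks:
    it is enough to test p and q one at a time. *)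
Lemma face_from_off (G F : {set V}) : off F \subset G ->
  (p \in F -> face K (p |: G)%SET) -> (q \in F -> face K (q |: G)%SET) ->
  face K G -> face K F.
Proof.
move=> FG Fp Fq KG.
have sp r : face K (r |: G)%SET -> face K (r |: off F)%SET.
  by apply: face_sub; exact: finset.setUS.
have FE v : v \in F -> v != p -> v != q -> v \in off F.
  by move=> vF vp vq; rewrite !inE vp vq.
have [pF|pF] := boolP (p \in F); have [qF|qF] := boolP (q \in F).
- apply: face_sub (link (off_p F) (off_q F) (sp _ (Fp pF)) (sp _ (Fq qF))).
  apply/fintype.subsetP => v vF; rewrite !inE.
  by case: eqVneq => //= _; case: eqVneq => //= _.
- apply: face_sub (sp _ (Fp pF)); apply/fintype.subsetP => v vF.
  rewrite in_setU1; case: eqVneq => //= vp; apply: FE => //.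
  by apply: contraNneq qF => <-.
- apply: face_sub (sp _ (Fq qF)); apply/fintype.subsetP => v vF.
  rewrite in_setU1; case: eqVneq => //= vq; apply: FE => //.
  by apply: contraNneq pF => <-.
- apply: face_sub KG; apply: fintype.subset_trans FG.
  apply/fintype.subsetP => v vF; apply: FE => //.
    by apply: contraNneq pF => <-.
  by apply: contraNneq qF => <-.
Qed.

(** The largest height of a superlevel set of y, outside p and q, that does not
    span a face together with r.  It vanishes when the support itself spans a
    face with r, and when it is less than t, the weights above t do so. *)
Definition depth (r : V) (y : V -> R) : R :=
  \big[Num.max/0]_(N : {set V} |
      [&& p \notin N, q \notin N & `[< ~ face K (r |: N)%SET >]])
    \big[Num.min/1]_(v in N) y v.

Lemma depth_ge0 r y : 0 <= depth r y.
Proof. exact: bigmax_ge_id. Qed.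

Lemma depth_eq0 r y : (forall v, 0 <= y v) ->
  face K (r |: off (supp y))%SET -> depth r y = 0.
Proof.
move=> y0 Kr; apply/le_anti/andP; split; last exact: depth_ge0.
apply: bigmax_le => // N /and3P[pN qN /asboolP KN].
have [v vN yv] : exists2 v, v \in N & y v = 0.
  apply: contrapT => /forall2NP yN; apply: KN; apply: face_sub Kr.
  apply: finset.setUS; apply/fintype.subsetP => v vN; rewrite !inE.
  case: (yN v) => // yv; apply/and3P; split; last exact/eqP.
    by apply: contraNneq qN => <-.
  by apply: contraNneq pN => <-.
by rewrite -yv; exact: bigmin_le_cond.
Qed.

(** If N is the set where y exceeds t and r + N is not a face, then N takes part
    in the maximum defining the depth and contributes at least t.  The bound
    t <= 1 covers the case of an empty N, whose minimum is 1 by convention. *)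
Lemma depth_lt r y (t : R) : t <= 1 -> depth r y < t ->
  face K (r |: off [set v | (t < y v)%R])%SET.
Proof.
move=> t1 dt; apply: contrapT => KN; move: dt; apply/negP; rewrite -leNgt.
set N := off _ in KN.
have NP : [&& p \notin N, q \notin N & `[< ~ face K (r |: N)%SET >]].
  by apply/and3P; split; [exact: off_p|exact: off_q|exact/asboolP].
apply: (le_trans _ (le_bigmax_cond 0
  (fun N : {set V} => \big[Num.min/1]_(v in N) y v) NP)).
apply: le_bigmin => // v; rewrite !inE => /and3P[_ _]; exact: ltW.
Qed.

Lemma continuous_depth (Z : topologicalType) r (h : Z -> V -> R) :
  (forall v, continuous (h^~ v)) -> continuous (fun z => depth r (h z)).
Proof.
move=> ch; rewrite /depth; apply: continuous_big.
  exact: max_continuous.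
move=> N _; apply: continuous_big; first exact: min_continuous.
by move=> v _; exact: ch.
Qed.

Definition merge_weight (x : V -> R) (v : V) : R :=
  if v == p then x p + x q else if v == q then 0 else x v.

Lemma sum_merge (x : V -> R) : \sum_v merge_weight x v = \sum_v x v.
Proof.
rewrite (bigD1 p) //= (bigD1 q) 1?eq_sym //= [RHS](bigD1 p) //=.
rewrite [in RHS](bigD1 q) 1?eq_sym //= /merge_weight eqxx qp eqxx add0r.
rewrite addrA; congr (_ + _); apply: eq_bigr => v /andP[vp vq].
by rewrite (negPf vp) (negPf vq).
Qed.

Lemma off_supp_merge (x : V -> R) : off (supp (merge_weight x)) = off (supp x).
Proof.
apply/finset.setP => v; rewrite !inE /merge_weight.
by case: (v == q) => //=; case: (v == p).
Qed.

Lemma merge_in_cone (x : realization R K) : in_cone L (merge_weight (bcoord x)).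
Proof.
have [x0 x1 xF] := bcoordP x; split.
- by move=> v; rewrite /merge_weight; do 2?case: ifP => _ //; rewrite addr_ge0.
- by apply: exists_neq0_of_sum1; rewrite sum_merge.
set F := supp (merge_weight _).
have offK : face K (off F).
  by rewrite /F off_supp_merge; exact: face_sub (off_sub _) xF.
have Fq : q \notin F by rewrite inE /merge_weight qp eqxx eqxx.
have [pF|pF] := boolP (p \in F); last first.
  have -> : F = off F.
    apply/finset.setP => v; rewrite !inE; case: (eqVneq v q) => [->|_] /=.
      by move: Fq; rewrite inE; apply: negbTE.
    by case: (eqVneq v p) => //= ->; move: pF; rewrite inE; apply: negbTE.
  by apply/L_off.
have -> : F = (p |: off F)%SET.
  apply/finset.setP => v; rewrite in_setU1; case: (eqVneq v p) => [->//|vp] /=.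
  rewrite !inE vp /=; case: (eqVneq v q) => //= ->.
  by move: Fq; rewrite inE; apply: negbTE.
apply/L_on => //.
have xoff r : r \in supp (bcoord x) -> face K (r |: off F)%SET.
  move=> rx; apply: face_sub xF; rewrite finset.subUset finset.sub1set rx /=.
  by rewrite /F off_supp_merge; exact: off_sub.
move: pF; rewrite inE /merge_weight eqxx => pF.
have [xp|xp] := eqVneq (bcoord x p) 0.
  by right; apply: xoff; rewrite inE; move: pF; rewrite xp add0r.
by left; apply: xoff; rewrite inE.
Qed.

Definition merge_map (x : realization R K) : realization R L :=
  normalize (merge_in_cone x).

Lemma bcoord_merge_map x : bcoord (merge_map x) =1 merge_weight (bcoord x).
Proof. by apply: bcoord_normalize1; rewrite sum_merge bcoord_sum. Qed.

Lemma continuous_merge_map : continuous merge_map.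
Proof.
have cb w := @continuous_bcoord R V K w.
apply: continuous_normalize => v; rewrite /merge_weight.
case: (v == p); first exact: continuous_fun_add.
by case: (v == q); [exact: cst_continuous|exact: cb].
Qed.

(** The affine function of e going from 0 at e = -t to t at e = t, cut off
    outside this interval.  At t = 0 it stays continuous because it is squeezed
    between 0 and t; no division by t occurs. *)
Definition share (t e : R) : R := Num.max 0 (Num.min t ((t + e) / 2)).

Lemma share_ge0 t e : 0 <= share t e.
Proof. by rewrite /share le_max lexx. Qed.

Lemma share_le t e : 0 <= t -> share t e <= t.
Proof. by move=> t0; rewrite /share ge_max t0 ge_min lexx. Qed.

Lemma share_gt0 t e : 0 <= t -> share t e != 0 -> 0 < t /\ - e < t.
Proof.
move=> t0 sn; have : 0 < share t e by rewrite lt_neqAle eq_sym sn share_ge0.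
by rewrite /share lt_max ltxx /= lt_min => /andP[-> ?]; split => //; lra.
Qed.

Lemma share_lt t e : 0 <= t -> t - share t e != 0 -> 0 < t /\ e < t.
Proof.
move=> t0; rewrite subr_eq0 => sn.
have : share t e < t by rewrite lt_neqAle eq_sym sn share_le.
rewrite /share gt_max => /andP[-> ]; rewrite gt_min ltxx /= => ?.
by split => //; lra.
Qed.

(** The lift of a point y of L to K, in homogeneous coordinates. *)
Definition split_weight (y : V -> R) (v : V) : R :=
  let a := share (y p) (depth q y - depth p y) in
  if v == p then a else if v == q then y p - a else Num.max 0 (y v - y p).

Lemma split_off (y : V -> R) : (forall v, 0 <= y v) ->
  off (supp (split_weight y)) = off [set v | (y p < y v)%R]%SET.
Proof.
move=> y0; apply/finset.setP => v; rewrite !inE /split_weight.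
case: (v == q) => //=; case: (v == p) => //=.
by rewrite eq_le le_max lexx andbT ge_max lexx /= subr_le0 -ltNge.
Qed.

Lemma off_above (y : V -> R) : 0 <= y p ->
  off [set v | (y p < y v)%R]%SET \subset off (supp y).
Proof.
move=> yp; apply/fintype.subsetP => v; rewrite !inE => /and3P[-> -> /=] pv.
by rewrite gt_eqF // (le_lt_trans yp).
Qed.

(** If y p > 0 then the support of y off p spans a face of K with p or with q,
    so one of the two depths is 0.  If the share of p is positive, then
    depth p - depth q < y p, and this gives depth p < y p in both cases;
    symmetrically for q.  By [depth_lt] the lowered support spans a face with p,
    respectively q. *)
Lemma face_split (y : realization R L) (h := bcoord y) :
  [/\ split_weight h p != 0 -> face K (p |: off [set v | (h p < h v)%R])%SET,
      split_weight h q != 0 -> face K (q |: off [set v | (h p < h v)%R])%SET &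
      face K (off [set v | (h p < h v)%R])%SET].
Proof.
have [y0 y1 yF] := bcoordP y; rewrite -/h -/(supp h) in y0 y1 yF.
have hp1 : h p <= 1 by exact: bcoord_le1.
have d0 : 0 < h p -> depth p h = 0 \/ depth q h = 0.
  move=> hp; have : face L (p |: off (supp h))%SET.
    apply: face_sub yF.
    by rewrite finset.subUset finset.sub1set off_sub inE gt_eqF.
  by case/(L_on (off_p _) (off_q _)) => /depth_eq0 ->//; [left|right].
have dp0 := depth_ge0 p h; have dq0 := depth_ge0 q h.
split.
- rewrite /split_weight eqxx => /share_gt0[//|hp dlt].
  by apply: depth_lt => //; case: (d0 hp) => E; rewrite E in dlt *; lra.
- rewrite /split_weight eqxx qp => /share_lt[//|hp dlt].
  by apply: depth_lt => //; case: (d0 hp) => E; rewrite E in dlt *; lra.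
- apply: face_sub (off_above (y0 p)) _; apply/L_off => //.
  exact: face_sub (off_sub _) yF.
Qed.

Lemma split_in_cone (y : realization R L) :
  in_cone K (split_weight (bcoord y)).
Proof.
have [y0 y1 yF] := bcoordP y; have [Fp Fq F0] := face_split y; split.
- move=> v; rewrite /split_weight; case: ifP => _; first exact: share_ge0.
  by case: ifP => _; rewrite ?subr_ge0 ?share_le // le_max lexx.
- apply: contrapT => /forallNP h_0.
  have {}h_0 v : split_weight (bcoord y) v = 0.
    by have /negP := h_0 v; rewrite negbK => /eqP.
  have yp : bcoord y p = 0.
    have := h_0 q; have := h_0 p; rewrite /split_weight eqxx => ->.
    by rewrite eqxx qp subr0.
  have yq : bcoord y q = 0.
    by apply/eqP; have := L_q yF; rewrite inE negbK.
  have := oner_neq0 R; rewrite -y1 big1 ?eqxx // => v _.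
  have [->//|vp] := eqVneq v p; have [->//|vq] := eqVneq v q.
  have := h_0 v; rewrite /split_weight (negPf vp) (negPf vq) yp subr0.
  by rewrite (max_idPr (y0 v)).
- apply: (@face_from_off (off [set v | (bcoord y p < bcoord y v)%R]%SET)) => //.
  + by rewrite split_off.
  + by rewrite inE.
  + by rewrite inE.
Qed.

Definition split_map (y : realization R L) : realization R K :=
  normalize (split_in_cone y).

Lemma continuous_split_map : continuous split_map.
Proof.
apply: continuous_normalize => v.
have cb w := @continuous_bcoord R V L w.
have cd r := @continuous_depth _ r (@bcoord R V L) cb.
have cs : continuous (fun y : realization R L =>
    share (bcoord y p) (depth q (bcoord y) - depth p (bcoord y))).
  apply: continuous_fun_max; first exact: cst_continuous.
  apply: continuous_fun_min; first exact: cb.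
  apply: continuous_fun_mul; last exact: cst_continuous.
  apply: continuous_fun_add; first exact: cb.
  by apply: continuous_fun_sub; exact: cd.
rewrite /split_weight; case: (v == p) => //; case: (v == q).
  exact: continuous_fun_sub.
apply: continuous_fun_max; first exact: cst_continuous.
exact: continuous_fun_sub.
Qed.

(** The intermediate stage of the homotopy from the identity of K to the lift
    of the contraction: the other weights are lowered already, while the
    weights of p and q are still the original ones. *)
Definition trim (x : V -> R) (v : V) : R :=
  if (v == p) || (v == q) then x v else Num.max 0 (x v - (x p + x q)).

Lemma supp_trim (x : V -> R) : (forall v, 0 <= x v) ->
  supp (trim x) \subset supp x.
Proof.
move=> x0; apply/fintype.subsetP => v; rewrite !inE /trim; case: ifP => // _.
apply: contraNneq => ->; apply/eqP/max_idPl; rewrite sub0r oppr_le0.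
exact: addr_ge0.
Qed.

Lemma trim_in_cone (x : realization R K) : in_cone K (trim (bcoord x)).
Proof.
have [x0 x1 xF] := bcoordP x; split.
- by move=> v; rewrite /trim; case: ifP => _ //; rewrite le_max lexx.
- apply: contrapT => /forallNP h_0.
  have {}h_0 v : trim (bcoord x) v = 0.
    by have /negP := h_0 v; rewrite negbK => /eqP.
  have xp : bcoord x p = 0 by have := h_0 p; rewrite /trim eqxx.
  have xq : bcoord x q = 0 by have := h_0 q; rewrite /trim eqxx orbT.
  have := oner_neq0 R; rewrite -x1 big1 ?eqxx // => v _.
  have [->//|vp] := eqVneq v p; have [->//|vq] := eqVneq v q.
  have := h_0 v; rewrite /trim (negPf vp) (negPf vq) xp xq addr0 subr0.
  by rewrite (max_idPr (x0 v)).
- exact: face_sub (supp_trim x0) xF.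
Qed.

Definition trim_map (x : realization R K) : realization R K :=
  normalize (trim_in_cone x).

Lemma continuous_trim_map : continuous trim_map.
Proof.
have cb w := @continuous_bcoord R V K w.
apply: continuous_normalize => v; rewrite /trim.
case: (_ || _); first exact: cb.
apply: continuous_fun_max; first exact: cst_continuous.
by apply: continuous_fun_sub => //; exact: continuous_fun_add.
Qed.

Theorem contraction_equivalence :
  homotopy_equivalent R (realization R K) (realization R L).
Proof.
have cid (M : scomplex V) : continuous (@id (realization R M)) by move=> x.
have cm := continuous_merge_map; have cs := continuous_split_map.
have ct := continuous_trim_map.
exists merge_map, split_map; split=> //.
- apply: (@homotopic_trans _ _ _ trim_map).
  + (* Both supports have the same part off p and q; p is present only if it
       spans a face with that part, in both cases, and likewise q. *)
    apply: homotopic_straight => //; first exact: (continuous_o cm cs).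
    move=> x /=; rewrite !supp_normalize.
    set y := merge_map x; set h := bcoord y.
    have hE : h =1 merge_weight (bcoord x) by exact: bcoord_merge_map.
    have [Fp Fq F0] := face_split y; rewrite -/h in Fp Fq F0.
    have hp : h p = bcoord x p + bcoord x q by rewrite hE /merge_weight eqxx.
    have [x0 x1 xF] := bcoordP x.
    have sub_x : off [set v | (h p < h v)%R]%SET \subset supp (bcoord x).
      apply/fintype.subsetP => v; rewrite !inE hp hE /merge_weight.
      move=> /and3P[vq vp]; rewrite (negPf vq) (negPf vp) => lt_v.
      rewrite gt_eqF //.
      by apply: le_lt_trans lt_v; exact: addr_ge0.
    have x_ok r : bcoord x r != 0 ->
        face K (r |: off [set v | (h p < h v)%R])%SET.
      move=> xr; apply: face_sub xF.
      by rewrite finset.subUset sub_x finset.sub1set inE xr.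
    apply: (@face_from_off (off [set v | (h p < h v)%R]%SET)) => //.
    * apply/fintype.subsetP => v; rewrite !inE => /and3P[vq vp].
      rewrite vq vp /= /split_weight /trim (negPf vq) (negPf vp) /=.
      rewrite -hp -(_ : h v = bcoord x v); last first.
        by rewrite hE /merge_weight (negPf vq) (negPf vp).
      by rewrite orbb eq_le le_max lexx andbT ge_max lexx /= subr_le0 -ltNge.
    * rewrite !inE => /orP[/Fp //|]; rewrite /trim eqxx; exact: x_ok.
    * rewrite !inE => /orP[/Fq //|]; rewrite /trim eqxx orbT; exact: x_ok.
  + apply: homotopic_straight => // x.
    have [x0 x1 xF] := bcoordP x.
    apply: face_sub xF; rewrite finset.subUset supp_normalize supp_trim //=.
- (* Contracting after lifting only shrinks the support. *)
  apply: homotopic_straight => //; first exact: (continuous_o cs cm).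
  move=> y /=; have [y0 y1 yF] := bcoordP y.
  apply: face_sub yF; rewrite finset.subUset fintype.subxx andbT.
  apply/fintype.subsetP => v; rewrite !inE bcoord_merge_map /merge_weight.
  have sE r : bcoord (split_map y) r != 0 -> split_weight (bcoord y) r != 0.
    by rewrite bcoord_normalize mulf_eq0 negb_or => /andP[].
  case: (eqVneq v p) => [-> n0|vp].
    apply: contraNneq n0 => yp.
    have s0 : share 0 (depth q (bcoord y) - depth p (bcoord y)) = 0.
      by apply/le_anti; rewrite share_ge0 share_le.
    rewrite !bcoord_normalize /split_weight eqxx qp eqxx yp s0.
    by rewrite subr0 mul0r addr0.
  case: (eqVneq v q) => [_|vq]; first by rewrite eqxx.
  move/sE; rewrite /split_weight (negPf vp) (negPf vq).
  by apply: contraNneq => ->; apply/eqP/max_idPl; rewrite sub0r oppr_le0.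
Qed.

End Contraction.

(** * Path-free sets and the splitting of a vertex *)

(** The element (v, true) stands for the vertex v before splitting and for its
    source part after splitting; (v, false) is the sink part.  The predicate sp
    tells which vertices are split. *)
Section PathFree.
Variables (T : finType) (n : nat) (lev : T -> nat) (d : rel T).
Hypothesis d_lev : forall u v, d u v -> lev v = (lev u).+1.
Implicit Types (sp : pred T) (F G : {set (T * bool)}) (z w : T * bool).

Definition source sp z := z.2 && sp z.1.

Definition sink z := ~~ z.2.

Definition is_vertex sp z :=
  if z.2 then (lev z.1 < n)%N else (0 < lev z.1)%N && sp z.1.

Definition arc sp z w := [&& z.2, d z.1 w.1 & ~~ source sp w].

(** Absence of directed paths from sources to sinks in F is witnessed by a set B
    containing the sources of F, closed under the arcs of F and avoiding the
    sinks of F.  Such a witness is easier to transport than paths are. *)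
Definition separates sp F (B : {set (T * bool)}) := forall z, z \in F ->
  [/\ source sp z -> z \in B, sink z -> z \notin B &
      forall w, w \in F -> z \in B -> arc sp z w -> w \in B].

Definition path_free sp F : Prop :=
  (forall z, z \in F -> is_vertex sp z) /\ exists B, separates sp F B.

Lemma path_free0 sp : path_free sp finset.set0.
Proof.
by split=> [z|]; [rewrite inE|exists finset.set0 => z; rewrite inE].
Qed.

Lemma path_free_sub sp F G : G \subset F -> path_free sp F -> path_free sp G.
Proof.
move=> /fintype.subsetP GF [Fc [B FB]]; split=> [z /GF/Fc //|].
by exists B => z /GF/FB[Bs Bt Ba]; split=> // w /GF; exact: Ba.
Qed.

Definition path_free_complex sp : scomplex (T * bool)%type :=
  SComplex (path_free0 sp) (@path_free_sub sp).

(** The vertex a is not split by sp, and sp' splits it in addition. *)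
Section SplitOne.
Variables (sp sp' : pred T) (a : T).
Hypotheses (a_gt0 : (0 < lev a)%N) (a_ltn : (lev a < n)%N).
Hypotheses (sp_a : ~~ sp a) (sp'E : forall v, sp' v = (v == a) || sp v).

Let p := (a, true).
Let q := (a, false).

Let p_neq_q : p != q.
Proof. by rewrite xpair_eqE andbF. Qed.

Let other z : z != p -> z != q -> sp' z.1 = sp z.1.
Proof.
case: z => v b /=; rewrite sp'E /p /q; case: (eqVneq v a) => //= ->.
by case: b; rewrite eqxx.
Qed.

Let off_neq G z : p \notin G -> q \notin G -> z \in G -> z != p /\ z != q.
Proof. by move=> pG qG zG; split; apply: contraTneq zG => ->. Qed.

Let is_vertex_other z : z != p -> z != q -> is_vertex sp' z = is_vertex sp z.
Proof. by move=> zp zq; rewrite /is_vertex other. Qed.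

Let source_other z : z != p -> z != q -> source sp' z = source sp z.
Proof. by move=> zp zq; rewrite /source other. Qed.

Let arc_other z w : w != p -> w != q -> arc sp' z w = arc sp z w.
Proof. by move=> wp wq; rewrite /arc source_other. Qed.

Let arc'p z : arc sp' z p = false.
Proof. by rewrite /arc /source /= sp'E eqxx !andbF. Qed.

Let arc'q z : arc sp' z q = arc sp z p.
Proof. by rewrite /arc /source /= (negPf sp_a). Qed.

Lemma path_free_merged F : path_free sp F -> q \notin F.
Proof.
move=> [Fc _]; apply/negP => /Fc.
by rewrite /is_vertex /= (negPf sp_a) andbF.
Qed.

Lemma path_free_off G : p \notin G -> q \notin G ->
  path_free sp G <-> path_free sp' G.
Proof.
move=> pG qG; have oG z := @off_neq G z pG qG.
split=> -[Gc [B GB]]; split.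
- by move=> z zG; have [zp zq] := oG z zG; rewrite is_vertex_other ?Gc.
- exists B => z zG; have [zp zq] := oG z zG; have [Bs Bt Ba] := GB z zG.
  split=> // [|w wG]; first by rewrite source_other.
  by have [wp wq] := oG w wG; rewrite arc_other //; exact: Ba.
- by move=> z zG; have [zp zq] := oG z zG; rewrite -is_vertex_other ?Gc.
- exists B => z zG; have [zp zq] := oG z zG; have [Bs Bt Ba] := GB z zG.
  split=> // [|w wG]; first by rewrite -source_other.
  by have [wp wq] := oG w wG; rewrite -arc_other //; exact: Ba.
Qed.

(** A separating set for G + a serves for G + p or for G + q, according to
    whether it contains a; conversely, adding a to a set separating G + p, or
    leaving it out of a set separating G + q, separates G + a. *)
Lemma path_free_on G : p \notin G -> q \notin G ->
  path_free sp (p |: G)%SET <->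
  path_free sp' (p |: G)%SET \/ path_free sp' (q |: G)%SET.
Proof.
move=> pG qG; have oG z := @off_neq G z pG qG.
have inG z : z \in G -> z \in (p |: G)%SET /\ z \in (q |: G)%SET.
  by move=> zG; rewrite !finset.in_setU1 zG !orbT.
have [pp qq] : p \in (p |: G)%SET /\ q \in (q |: G)%SET by rewrite !setU11.
split.
- move=> [Fc [B FB]]; have [pB|pB] := boolP (p \in B).
  + left; split=> [z|].
      case/setU1P => [-> //|zG]; have [zp zq] := oG z zG.
      by rewrite is_vertex_other ?Fc //; case: (inG z zG).
    exists B => z zF; have [Bs Bt Ba] := FB z zF; split=> //.
      move: zF => /setU1P[-> //|zG]; have [zp zq] := oG z zG.
      by rewrite source_other.
    move=> w /setU1P[-> //|wG]; have [wp wq] := oG w wG.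
    by rewrite arc_other //; apply: Ba; case: (inG w wG).
  + right; split=> [z|].
      case/setU1P => [->|zG]; first by rewrite /is_vertex /= a_gt0 sp'E eqxx.
      have [zp zq] := oG z zG.
      by rewrite is_vertex_other ?Fc //; case: (inG z zG).
    exists (B :\ q)%SET => z /setU1P[->|zG].
      by split=> //; rewrite !inE eqxx.
    have [zp zq] := oG z zG; have [zGp zGq] := inG z zG.
    have [Bs Bt Ba] := FB z zGp.
    rewrite !inE zq /=; split; [by rewrite source_other|exact: Bt|].
    move=> w /setU1P[->|wG] zB; rewrite !inE ?eqxx /=.
      by rewrite arc'q => /(Ba p pp zB); rewrite (negPf pB).
    have [wp wq] := oG w wG; rewrite arc_other // wq /=.
    by apply: Ba => //; case: (inG w wG).
- case=> -[Fc [B FB]]; split.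
  + move=> z /setU1P[->//|zG]; have [zp zq] := oG z zG.
    by rewrite -is_vertex_other ?Fc //; case: (inG z zG).
  + have pB : p \in B.
      by case: (FB p pp) => + _ _; apply; rewrite /source /= sp'E eqxx.
    exists B => z zF; have [Bs Bt Ba] := FB z zF; split=> //.
      move: zF => /setU1P[-> //|zG]; have [zp zq] := oG z zG.
      by rewrite -source_other.
    move=> w /setU1P[-> //|wG]; have [wp wq] := oG w wG.
    by rewrite -arc_other //; apply: Ba; case: (inG w wG).
  + move=> z /setU1P[->//|zG]; have [zp zq] := oG z zG.
    by rewrite -is_vertex_other ?Fc //; case: (inG z zG).
  + have qB : q \notin B by case: (FB q qq) => _ + _; exact.
    exists (B :\ p)%SET => z /setU1P[->|zG].
      by split=> //; rewrite ?inE ?eqxx // /source /= (negPf sp_a).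
    have [zp zq] := oG z zG; have [zGp zGq] := inG z zG.
    have [Bs Bt Ba] := FB z zGq.
    rewrite !inE zp /=; split; [by rewrite -source_other|exact: Bt|].
    move=> w /setU1P[->|wG] zB; rewrite !inE ?eqxx /=.
      by rewrite -arc'q => /(Ba q qq zB); rewrite (negPf qB).
    have [wp wq] := oG w wG; rewrite -arc_other // wp /=.
    by apply: Ba => //; case: (inG w wG).
Qed.

(** Take separating sets B1 of G + p and B2 of G + q.  Above the layer of a only
    B1 knows about the vertices reached from p; up to this layer, intersecting
    with B2 keeps the arcs from entering q.  Closure under arcs holds since each
    arc goes up by exactly one layer. *)
Lemma path_free_link G : p \notin G -> q \notin G ->
  path_free sp' (p |: G)%SET -> path_free sp' (q |: G)%SET ->
  path_free sp' (p |: (q |: G))%SET.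
Proof.
move=> pG qG [Fc1 [B1 FB1]] [Fc2 [B2 FB2]].
have oG z := @off_neq G z pG qG.
have inG z : z \in G -> z \in (p |: G)%SET /\ z \in (q |: G)%SET.
  by move=> zG; rewrite !finset.in_setU1 zG !orbT.
have [pp qq] : p \in (p |: G)%SET /\ q \in (q |: G)%SET by rewrite !setU11.
have pB1 : p \in B1.
  by case: (FB1 p pp) => + _ _; apply; rewrite /source /= sp'E eqxx.
have qB2 : q \notin B2 by case: (FB2 q qq) => _ + _; exact.
split.
  by move=> z /setU1P[->|/Fc2 //]; exact: Fc1.
exists [set z in B1 |
  (z != q) && [|| z == p, (lev a < lev z.1)%N | z \in B2]]%SET.
have step z w : z \in G -> w \in (p |: (q |: G))%SET -> z \in B1 ->
    (lev a < lev z.1)%N || (z \in B2) -> arc sp' z w ->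
    w \in G /\ w \in B1 /\ ((lev a < lev w.1)%N || (w \in B2)).
  move=> zG + zB1 zB2 zw; have [zGp zGq] := inG z zG.
  have [_ _ Ba1] := FB1 z zGp; have [_ _ Ba2] := FB2 z zGq.
  have lw : lev w.1 = (lev z.1).+1 by case/and3P: zw => _ /d_lev.
  case/setU1P => [wp|/setU1P[wq|wG]]; first by rewrite wp arc'p in zw.
    move: zB2; rewrite wq /= in lw; rewrite lw ltnNge leqnSn /= => zB2.
    by rewrite wq in zw; have := Ba2 q qq zB2 zw; rewrite (negPf qB2).
  have [wGp wGq] := inG w wG; split=> //; split; first exact: Ba1 zw.
  case/orP: zB2 => [lz|zB2]; last by rewrite (Ba2 w wGq zB2 zw) orbT.
  by rewrite lw ltnS (ltnW lz).
move=> z /setU1P[->|/setU1P[->|zG]].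
- split=> //.
    by rewrite !inE pB1 eqxx p_neq_q.
  move=> w /setU1P[->|/setU1P[->|wG]] _ pw.
  + by rewrite arc'p in pw.
  + by case/and3P: pw => _ /d_lev /= /eqP; rewrite ltn_eqF.
  + have [wp wq] := oG w wG; have [wGp _] := inG w wG.
    have [_ _ Ba1] := FB1 p pp; rewrite !inE (Ba1 w wGp pB1 pw) wq /=.
    by case/and3P: pw => _ /d_lev /= -> _; rewrite ltnSn orbT.
- by split=> //; rewrite !inE eqxx ?andbF //.
- have [zp zq] := oG z zG; have [zGp zGq] := inG z zG.
  have [Bs1 Bt1 _] := FB1 z zGp; have [Bs2 _ _] := FB2 z zGq.
  rewrite !inE zq (negPf zp) /=; split.
  + by move=> zs; rewrite Bs1 // Bs2 // orbT.
  + by move=> /Bt1/negPf ->.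
  + move=> w wF /andP[zB1 zB2] /(step z w zG wF zB1 zB2) [wG [wB1 wB2]].
    by have [wp wq] := oG w wG; rewrite !inE wB1 wq wB2 orbT.
Qed.

Lemma split_one_equivalence (R : realType) :
  homotopy_equivalent R (realization R (path_free_complex sp'))
                        (realization R (path_free_complex sp)).
Proof.
apply: (@contraction_equivalence R _ _ _ p q) => //.
- exact: path_free_merged.
- exact: path_free_off.
- exact: path_free_on.
- exact: path_free_link.
Qed.

End SplitOne.

(** The vertices of the first and of the last layer count as split throughout:
    their source, respectively sink, is their only copy. *)
Definition split_at (s : seq T) : pred T :=
  fun v => [|| lev v == 0%N, (n <= lev v)%N | v \in s].

Lemma split_equivalence (R : realType) (s : seq T) :
  homotopy_equivalent R (realization R (path_free_complex (split_at s)))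
                        (realization R (path_free_complex (split_at [::]))).
Proof.
elim: s => [|a s IHs].
  apply: (@relabelling_equivalence R _ _ _ _ id id) => // F;
    by rewrite imset_id.
have [sa|nsa] := boolP (split_at s a).
  suff -> : split_at (a :: s) = split_at s by [].
  apply/funext => v; rewrite /split_at in_cons.
  by case: (eqVneq v a) => //= ->; rewrite orbT orbT; apply/esym.
apply: homotopy_equivalent_trans IHs.
apply: (@split_one_equivalence _ _ a) => //.
- by move: nsa; rewrite lt0n; apply: contraNneq; rewrite /split_at => ->.
- by move: nsa; rewrite ltnNge; apply: contra; rewrite /split_at orbCA => ->.
- by move=> v; rewrite /split_at in_cons; case: (v == a); rewrite ?orbT.
Qed.

End PathFree.

Local Close Scope classical_set_scope.

(** * Faces from Stanley-Reisner ideals *)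

Lemma natb_eq0 (k : fieldType) (b : bool) : (b%:R == 0 :> k) = ~~ b.
Proof. by case: b; rewrite ?oner_eq0 ?eqxx. Qed.

Section IdealEvaluation.
Variables (k : fieldType) (V : finType).

(** Evaluation at the 0/1 point of F does not vanish on a monomial exactly when
    all its variables lie in F, so membership of monomials in a monomial ideal
    can be tested without any monomial division. *)
Definition indicator_eval (F : {set V}) : polyring k V -> k :=
  @mpoly.meval #|V| k (fun i => (enum_val i \in F)%:R).

Lemma indicator_eval_var F v : indicator_eval F (pvar k v) = (v \in F)%:R.
Proof. by rewrite /indicator_eval /pvar mpoly.mevalXU enum_rankK. Qed.

Lemma indicator_evalM F r s :
  indicator_eval F (r * s) = indicator_eval F r * indicator_eval F s.
Proof. exact: rmorphM. Qed.

Lemma indicator_eval_prod (F : {set V}) (I : finType) (P : pred I)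
    (a : I -> V) :
  indicator_eval F (\prod_(i | P i) pvar k (a i)) =
  [forall (i | P i), a i \in F]%:R.
Proof.
rewrite /indicator_eval rmorph_prod /=.
rewrite (eq_bigr (fun i => (a i \in F)%:R)); last first.
  by move=> i _; exact: indicator_eval_var.
have [/forall_inP aF|] := boolP [forall (i | P i), a i \in F].
  by rewrite big1 // => i /aF ->.
rewrite negb_forall_in => /exists_inP[i Pi aiF].
by rewrite (bigD1 i) //= (negPf aiF) mul0r.
Qed.

Lemma ideal_gen_self (S : set (polyring k V)) g : S g -> ideal_gen S g.
Proof.
move=> Sg; exists 1%N, (fun=> 1), (fun=> g); split=> //.
by rewrite big_ord1 mul1r.
Qed.

Lemma ideal_gen_eval (S : set (polyring k V)) F r :
  ideal_gen S r -> indicator_eval F r != 0 ->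
  exists2 g, S g & indicator_eval F g != 0.
Proof.
move=> [m [c [g [Sg ->]]]] nz; apply: contrapT => /forall2NP g0.
move: nz; rewrite /indicator_eval rmorph_sum big1 ?eqxx //= => j _.
have [//|/negP] := g0 (g j); rewrite negbK => /eqP gj0.
by rewrite rmorphM /= [X in _ * X]gj0 mulr0.
Qed.

(** If F is not a face, its monomial lies in the ideal and takes the value 1 at
    the point of F, so some generator does not vanish there.  Conversely such a
    generator lies in the Stanley-Reisner ideal, so the monomial of some nonface
    does not vanish at the point of F, that is, F contains a nonface. *)
Lemma nonface_gen (K : scomplex V) (S : set (polyring k V)) (F : {set V}) :
  SR_ideal k K = ideal_gen S ->
  ~ face K F <-> exists2 g, S g & indicator_eval F g != 0.
Proof.
move=> KS; split.
  move=> KF; apply: (@ideal_gen_eval _ _ (\prod_(v in F) pvar k v)).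
    by rewrite -KS; apply: ideal_gen_self; exists F.
  rewrite indicator_eval_prod (_ : [forall (_ | _), _]) ?oner_neq0 //.
  by apply/forall_inP.
move=> [g /ideal_gen_self]; rewrite -KS => /ideal_gen_eval/[apply].
move=> [_ [N [KN ->]]]; rewrite indicator_eval_prod natb_eq0 negbK.
move=> /forall_inP NF KF; apply: KN; apply: face_sub KF.
by apply/fintype.subsetP => v /NF.
Qed.

Lemma edge_ideal_face (K : scomplex V) (e : rel V) (F : {set V}) :
  SR_ideal k K = edge_ideal k e ->
  face K F <-> forall u v, u \in F -> v \in F -> ~~ e u v.
Proof.
move=> /nonface_gen KF; split.
  move=> Ff u v uF vF; apply/negP => euv; move: Ff; apply/KF.
  exists (pvar k u * pvar k v); first by exists u, v.
  by rewrite indicator_evalM !indicator_eval_var uF vF mulr1 oner_neq0.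
move=> Fe; apply: contrapT => /KF[_ [u [v [euv ->]]]].
rewrite indicator_evalM !indicator_eval_var -natrM mulnb natb_eq0 negbK.
by move=> /andP[uF vF]; move: (Fe u v uF vF); rewrite euv.
Qed.

End IdealEvaluation.

Lemma path_ideal_face (k : fieldType) (n : nat) (T : finType)
    (A : 'I_n.+1 -> {set T}) (e : rel T) (K : scomplex T) (F : {set T}) :
  SR_ideal k K = layer_path_ideal A e k ->
  face K F <-> forall a : 'I_n.+1 -> T, (forall i, a i \in A i) ->
    (forall i, a i \in F) -> exists i : 'I_n, ~~ e (a (prevL i)) (a (nextL i)).
Proof.
move=> /nonface_gen KF; split.
  move=> + a aA aF; apply: contraPP => /forallNP ae; apply/KF.
  exists (\prod_i pvar k (a i)).
    by exists a; split=> // i; apply/negPn/negP/ae.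
  rewrite (indicator_eval_prod _ _ xpredT) natb_eq0 negbK.
  by apply/forallP => i; rewrite aF.
move=> Fa; apply: contrapT => /KF[_ [a [aA ae ->]]].
rewrite (indicator_eval_prod _ _ xpredT) natb_eq0 negbK => /forallP aF.
by have [i] := Fa a aA aF; rewrite ae.
Qed.

(** * The two ends of the chain of splittings *)

Lemma face_join (I : finType) (V : I -> finType) (K : forall i, scomplex (V i))
    (F : {set {i : I & V i}}) :
  face (join K) F <-> forall i, face (K i) [set v | Tagged V v \in F]%SET.
Proof.
split=> [[G [KG ->]] i|KF].
  apply: face_sub (KG i); apply/fintype.subsetP => v; rewrite inE.
  move=> /bigcupP[j _ /imsetP[w wG E]].
  have ij : i = j by exact: (congr1 tag E).
  case: j / ij w wG E => w wG E.
  by move/eqP: E; rewrite eq_Tagged => /eqP /= ->.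
exists (fun i => [set v | Tagged V v \in F]%SET); split=> //.
apply/finset.setP => -[i v]; apply/idP/bigcupP => [vF|[j _ /imsetP[w]]].
  by exists i => //; apply/imsetP; exists v; rewrite ?inE.
by rewrite inE => wF ->.
Qed.

Section Layers.
Variables (n : nat) (n_gt0 : (0 < n)%N) (T : finType) (A : 'I_n.+1 -> {set T}).
Variable e : rel T.
Hypothesis A_disj : forall i j : 'I_n.+1, i != j -> [disjoint A i & A j].
Hypothesis A_cover : forall v : T, exists i : 'I_n.+1, v \in A i.

Definition lev (v : T) : 'I_n.+1 := xchoose (A_cover v).

Lemma lev_in v : v \in A (lev v).
Proof. exact: xchooseP (A_cover v). Qed.

Lemma in_layer v i : (v \in A i) = (lev v == i).
Proof.
apply/idP/eqP => [vi|<-]; last exact: lev_in.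
apply/eqP/negPn/negP => /A_disj /disjoint_setI0 /finset.setP /(_ v).
by rewrite inE lev_in vi inE.
Qed.

Definition dedge : rel T := fun u v => e u v && (lev v == (lev u).+1 :> nat).

Lemma dedge_lev u v : dedge u v -> (lev v : nat) = (lev u).+1.
Proof. by case/andP => _ /eqP. Qed.

Definition split_complex (s : seq T) : scomplex (T * bool)%type :=
  path_free_complex n lev dedge (split_at n lev s).

(** Vertices of layer j that are ends of paths inside F from the first layer. *)
Fixpoint reach (F : {set T}) (j : nat) : {set T} :=
  if j is i.+1 then
    [set v in F | (lev v == j :> nat) && [exists u in reach F i, e u v]]%SET
  else [set v in F | lev v == 0 :> nat]%SET.

Lemma reachP F j v : v \in reach F j -> exists a : nat -> T,
  [/\ a j = v, forall i, (i <= j)%N -> a i \in F /\ lev (a i) = i :> nat &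
      forall i, (i < j)%N -> e (a i) (a i.+1)].
Proof.
elim: j v => [|j IHj] v /=; rewrite !inE.
  move=> /andP[vF /eqP lv]; exists (fun=> v); split=> // i.
  by rewrite leqn0 => /eqP ->.
move=> /and3P[vF /eqP lv /exists_inP[u /IHj[a [au aF ae]] uv]].
exists (fun i => if i == j.+1 then v else a i); split.
- by rewrite eqxx.
- move=> i; rewrite leq_eqVlt; case: eqP => [->//|_ /=]; exact: aF.
- move=> i; rewrite ltnS leq_eqVlt => /predU1P[->|ij].
    by rewrite eqxx ltn_eqF // au.
  by rewrite !ltn_eqF //; [exact: ae|exact: ltnW].
Qed.

(** Without inner splittings every vertex has a single copy: the sink in the
    last layer, and the element carrying true elsewhere.  The vertices reachable
    from the first layer inside F separate; conversely a separating set contains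
    every vertex of a path starting in the first layer. *)
Lemma path_complex_equivalence (R : realType) (k : fieldType) (X : scomplex T) :
  SR_ideal k X = layer_path_ideal A e k ->
  homotopy_equivalent R (realization R X) (realization R (split_complex [::])).
Proof.
move=> hX; pose phi v := (v, (lev v < n)%N).
have phiK z : is_vertex n lev (split_at n lev [::]) z -> phi z.1 = z.
  case: z => v [] /=; rewrite /is_vertex /phi /=; first by move=> ->.
  rewrite /split_at in_nil orbF => /andP[l0 l_n].
  by rewrite ltnNge; move: l_n; rewrite -leqn0 leqNgt l0 /= => ->.
apply: (@relabelling_equivalence R _ _ _ _ phi fst) => //.
- move=> F /(path_ideal_face _ hX) Fa; split.
    move=> _ /imsetP[v vF ->]; rewrite /is_vertex /phi /=; case: ltnP => // lv.
    by rewrite (leq_trans n_gt0 lv) /split_at lv orbT.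
  exists [set z : T * bool | z.1 \in reach F (lev z.1)]%SET.
  move=> _ /imsetP[v vF ->]; rewrite !inE /=; split.
  + rewrite /source /split_at /= in_nil orbF => /andP[lv].
    rewrite leqNgt lv orbF => /eqP lv0.
    by rewrite lv0 !inE vF lv0 eqxx.
  + rewrite /sink /= -leqNgt => lv; apply/negP => /reachP[a [av aF ae]].
    have lvn : (lev v : nat) = n.
      by apply/eqP; rewrite eqn_leq lv andbT -ltnS ltn_ord.
    have [||i] := Fa (fun i => a (val i)).
    * move=> i; rewrite in_layer -val_eqE /=.
      by have [|_ ->] := aF i; rewrite // lvn -ltnS.
    * by move=> i; have [|->] := aF i; rewrite // lvn -ltnS.
    * by rewrite /= /bump leq0n add1n ae // lvn.
  + move=> _ /imsetP[w wF ->] /= vr; rewrite inE /=.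
    move=> /and3P[_ /= /andP[vw /eqP lw] _]; rewrite lw /= !inE wF lw eqxx /=.
    by apply/exists_inP; exists v.
- move=> F [Fc [B FB]]; apply/(path_ideal_face _ hX) => a aA aF.
  apply: contrapT => /forallNP ae.
  have la i : lev (a i) = i by apply/eqP; rewrite -in_layer.
  have phiF i : phi (a i) \in F.
    have /imsetP[z zF ->] := aF i; by rewrite phiK // Fc.
  have inB (i : nat) (hi : (i < n.+1)%N) : phi (a (Ordinal hi)) \in B.
    elim: i hi => [|i IHi] hi; have [Bs Bt _] := FB _ (phiF (Ordinal hi)).
      by apply: Bs; rewrite /source /phi /split_at /= la /= n_gt0.
    have hi' : (i < n.+1)%N by exact: ltnW.
    have [_ _ Ba] := FB _ (phiF (Ordinal hi')).
    apply: Ba => //; rewrite /arc /phi /= !la /= -ltnS hi /=.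
    rewrite /dedge !la /= eqxx andbT /source /split_at /= la in_nil /=.
    rewrite orbF (leqNgt n) andbN andbT.
    have /negP := ae (Ordinal (hi : (i < n)%N)); rewrite negbK.
    congr (e (a _) (a _)); exact: val_inj.
  have [_ Bt _] := FB _ (phiF ord_max).
  have := inB n (ltnSn n).
  rewrite (_ : Ordinal _ = ord_max); last exact: val_inj.
  by apply/negP/Bt; rewrite /sink /phi /= la ltnn.
- move=> z [Fc _]; apply: phiK; apply: Fc; exact: finset.set11.
Qed.

(** The source part of a vertex of layer i belongs to the join factor with lower
    layer i, its sink part to the one with upper layer i.  The truncations only
    concern elements that are no vertices: the source part in the last layer and
    the sink part in the first one. *)
Definition half_idx (z : T * bool) : nat :=
  if z.2 then minn (lev z.1) n.-1 else (lev z.1).-1.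

Lemma half_idx_lt z : (half_idx z < n)%N.
Proof.
rewrite /half_idx; case: z.2.
  by rewrite (leq_ltn_trans (geq_minr _ _)) // ltn_predL.
by case: (lev z.1) => -[|m].
Qed.

Definition half (z : T * bool) : 'I_n := Ordinal (half_idx_lt z).

Lemma in_layerU (i : 'I_n) v : (v \in A (prevL i) :|: A (nextL i))%SET =
  (lev v == i :> nat) || (lev v == i.+1 :> nat).
Proof. by rewrite finset.in_setU !in_layer -!val_eqE /= /bump leq0n add1n. Qed.

Lemma half_layer z : z.1 \in (A (prevL (half z)) :|: A (nextL (half z)))%SET.
Proof.
rewrite in_layerU /half /= /half_idx; have := ltn_ord (lev z.1).
rewrite ltnS leq_eqVlt; case: z.2 => [/predU1P[->|ln]|_].
- by rewrite (minn_idPr (leq_pred n)) prednK // eqxx orbT.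
- by rewrite (minn_idPl _) ?eqxx // -ltnS prednK.
- by case: (lev z.1 : nat) => [|m] /=; rewrite ?eqxx ?orbT.
Qed.

Definition to_join (z : T * bool) : {i : 'I_n & layer A i} :=
  Tagged (layer A) (exist _ z.1 (half_layer z) : layer A (half z)).

Definition of_join (x : {i : 'I_n & layer A i}) : T * bool :=
  (val (tagged x), lev (val (tagged x)) == tag x :> nat).

Lemma of_joinK : cancel of_join to_join.
Proof.
have ext (x y : {i : 'I_n & layer A i}) :
    tag x = tag y -> val (tagged x) = val (tagged y) -> x = y.
  case: x y => [i u] [j v] /= ij; case: j / ij v => v uv.
  by congr (existT _ _ _); exact: val_inj.
case=> i u; apply: ext => //; apply: val_inj; rewrite /= /half_idx /=.
have := valP u; rewrite in_layerU; case: eqP => [->|_ /eqP ->] //= _.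
by apply/minn_idPl; rewrite -ltnS prednK.
Qed.

Lemma to_joinK z : is_vertex n lev (split_at n lev (enum T)) z ->
  of_join (to_join z) = z.
Proof.
case: z => v [] /=; rewrite /is_vertex /of_join /= /half_idx /=.
  move=> lv; congr (_, _); apply/eqP/esym/minn_idPl.
  by rewrite -ltnS prednK.
move=> /andP[lv _]; congr (_, _); apply/negbTE.
by rewrite -{1}(prednK lv) gtn_eqF.
Qed.

(** When every vertex is split, arcs run from sources to sinks only, so the set
    of all elements carrying true separates as soon as there is no arc. *)
Lemma join_equivalence (R : realType) (k : fieldType)
    (Xs : forall i : 'I_n, scomplex (layer A i)) :
  symmetric e ->
  (forall i : 'I_n, SR_ideal k (Xs i) = edge_ideal k (layer_edge A e i)) ->
  homotopy_equivalent R (realization R (split_complex (enum T)))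
                        (realization R (join Xs)).
Proof.
move=> e_sym hXs.
have all_split v : split_at n lev (enum T) v.
  by rewrite /split_at mem_enum !orbT.
apply: (@relabelling_equivalence R _ _ _ _ to_join of_join).
- move=> F [Fc [B FB]]; apply/face_join => i; apply/(edge_ideal_face _ (hXs i)).
  have inF (u : layer A i) : Tagged (fun j => layer A j) u \in to_join @: F ->
      (val u, lev (val u) == i :> nat) \in F.
    move=> /imsetP[z zF E]; have := to_joinK (Fc z zF).
    by rewrite -E /of_join /= => ->.
  move=> u v; rewrite !inE => uF vF; apply/negP; rewrite /layer_edge.
  wlog : u v uF vF / (val u \in A (prevL i)) && (val v \in A (nextL i)).
    move=> H /[dup] /andP[euv /orP[uv|uv]].
      exact: H.
    move=> _; apply: (H v u) => //; rewrite e_sym euv /=.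
    by rewrite /between uv.
  rewrite !in_layer -!val_eqE /= /bump leq0n add1n => /andP[/eqP lu /eqP lv].
  move=> /andP[euv _]; have {}uF := inF u uF; have {}vF := inF v vF.
  rewrite lu eqxx in uF; rewrite lv gtn_eqF // in vF.
  have [us _ ua] := FB _ uF; have [_ vt _] := FB _ vF.
  apply/negP: (vt isT); rewrite negbK; apply: ua => //.
    by apply: us; rewrite /source /= all_split.
  by rewrite /arc /= /dedge euv lu lv eqxx.
- move=> F /face_join FK; split.
    move=> _ /imsetP[[i u] uF ->]; rewrite /is_vertex /of_join /=.
    have := valP u; rewrite in_layerU all_split andbT.
    by case: eqP => [-> _|_ /= /eqP -> //]; exact: ltn_ord.
  exists [set z : T * bool | z.2]%SET => _ /imsetP[[i u] uF ->].
  rewrite !inE; split; [by case/andP|by []|].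
  move=> _ /imsetP[[j v] vF ->] /= lu; rewrite inE /= /arc /of_join /=.
  rewrite /source /= all_split andbT => /and3P[_ /andP[euv /eqP lv] nlv].
  exfalso; rewrite (eqP lu) in lv.
  have ij : i = j.
    apply: val_inj; have := valP v; rewrite in_layerU (negPf nlv) /= lv.
    by move=> /eqP[].
  case: j / ij v vF euv lv nlv => v vF euv lv _.
  have /(edge_ideal_face _ (hXs i)) := FK i.
  move=> /(_ u v); rewrite !inE => /(_ uF vF) /negP; apply.
  rewrite /layer_edge euv /between !in_layer -!val_eqE /= /bump leq0n add1n.
  by rewrite lu lv eqxx.
- by move=> z [Fc _]; apply: to_joinK; apply: Fc; exact: finset.set11.
- by move=> x _; exact: of_joinK.
Qed.

End Layers.

Theorem corollary2p7 (R : realType) (k : fieldType) (n : nat) (hn : (1 <= n)%N)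
    (T : finType) (A : 'I_n.+1 -> {set T}) (e : rel T)
    (e_sym : symmetric e) (e_irr : irreflexive e)
    (A_disj : forall i j : 'I_n.+1, i != j -> [disjoint A i & A j])
    (A_cover : forall v : T, exists i : 'I_n.+1, v \in A i)
    (e_layers : forall u v : T, e u v -> exists i : 'I_n, between A i u v)
    (Xs : forall i : 'I_n, scomplex (layer A i))
    (hXs : forall i : 'I_n, SR_ideal k (Xs i) = edge_ideal k (layer_edge A e i))
    (X : scomplex T)
    (hX : SR_ideal k X = layer_path_ideal A e k) :
  homotopy_equivalent R (realization R X) (realization R (join Xs)).
Proof.
apply: homotopy_equivalent_trans.
  exact: (path_complex_equivalence hn A_disj A_cover R hX).
apply: (homotopy_equivalent_trans _
  (join_equivalence hn A_disj A_cover R e_sym hXs)).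
apply: homotopy_equivalent_sym; apply: split_equivalence.
exact: dedge_lev.
Qed.
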